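(* Let $\Sigma$ be an alphabet and let $\mathcal{A}$ be any set of seriality axioms and intuitionistic path axioms over $\Sigma$. For every set of formulae $\mathscr{A} \subseteq \mathcal{L}(\Sigma)$ and every formula $A \in \mathcal{L}(\Sigma)$: if $\mathscr{A} \vdash_{\mathcal{A}}^{\Sigma} A$, then $\mathscr{A} \Vdash_{\mathcal{A}}^{\Sigma} A$.
   Context: **Alphabet.** An alphabet $\Sigma$ is a non-empty countable set of characters partitioned as $\Sigma = \Sigma^{+} \cup \Sigma^{-}$, $\Sigma^{+} \cap \Sigma^{-} = \emptyset$, where $\Sigma^{+} = \{a,b,c,\ldots\}$ (forward characters) and $\Sigma^{-} = \{\overline{a},\overline{b},\overline{c},\ldots\}$ (backward characters) have the same cardinality and $a \in \Sigma^{+}$ iff $\overline{a} \in \Sigma^{-}$. The converse operation $\overline{\cdot}$ maps each $a \in \Sigma^{+}$ to $\overline{a} \in \Sigma^{-}$ and vice versa, so $\overline{\overline{x}} = x$ for all $x \in \Sigma$. **Language.** Let $\Phi = \{p,q,r,\ldots\}$ be a denumerable set of propositional atoms. $\mathcal{L}(\Sigma)$ is the set of formulae given by $A ::= p \mid \bot \mid A \lor A \mid A \land A \mid A \supset A \mid \langle x \rangle A \mid [x] A$ with $p \in \Phi$, $x \in \Sigma$. Put ${\sim}A := A \supset \bot$ and $A \supset\subset B := (A \supset B) \land (B \supset A)$. **Axiomatization.** $\mathsf{HIK_m}(\Sigma)$ consists of the following, for each $x \in \Sigma$ (schematic in $A,B$): A0: any axiomatization of intuitionistic propositional logic (including the rule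 modus ponens); A1: $[x](A \supset B) \supset ([x]A \supset [x]B)$; A2: $[x](A \land B) \supset\subset ([x]A \land [x]B)$; A3: $\langle x\rangle(A \lor B) \supset\subset (\langle x\rangle A \lor \langle x\rangle B)$; A4: $[x](A \supset B) \supset (\langle x\rangle A \supset \langle x\rangle B)$; A5: $[x]A \land \langle x\rangle B \supset \langle x\rangle(A \land B)$; A6: ${\sim}\langle x\rangle\bot$; A7: $(A \supset [x]\langle\overline{x}\rangle A) \land (\langle x\rangle[\overline{x}]A \supset A)$; A8: $(\langle x\rangle A \supset [x]B) \supset [x](A \supset B)$; A9: $\langle x\rangle(A \supset B) \supset ([x]A \supset \langle x\rangle B)$; R1: from $A$ infer $[x]A$. The set $\mathcal{A}$ is an arbitrary collection of axioms (schematic in $A$) of the following two forms: seriality axioms $[x]A \supset \langle x\rangle A$ (for some $x\in\Sigma$), and intuitionistic path axioms $(\langle x_1\rangle\cdots\langle x_n\rangle A \supset \langle x\rangle A) \land ([x]A \supset [x_1]\cdots[x_n]A)$ (for some $n \geq 0$ and $x,x_1,\ldots,x_n \in \Sigma$). $\mathsf{HIK_m}(\Sigma,\mathcal{A}) := \mathsf{HIK_m}(\Sigma) \cup \mathcal{A}$, and $\mathsf{IK_m}(\Sigma,\mathcal{A})$ is the smallest set of formulae of $\mathcal{L}(\Sigma)$ containing all substitution instances of the axioms and closed under the inference rules. Write $\vdash_{\mathcal{A}}^{\Sigma} A$ iff $A \in \mathsf{IK_m}(\Sigma,\mathcal{A})$. For a set $\mathscr{A} \subseteq \mathcal{L}(\Sigma)$,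 write $\mathscr{A} \vdash_{\mathcal{A}}^{\Sigma} A$ iff $\vdash_{\mathcal{A}}^{\Sigma} B_1 \land \cdots \land B_n \supset A$ for some $B_1,\ldots,B_n \in \mathscr{A}$ ($n \geq 0$, the empty conjunction being $\bot \supset \bot$). **Models.** A bi-relational $\Sigma$-model is $M = (W, \leq, \{R_x \mid x \in \Sigma\}, V)$ where $W$ is a non-empty set; $\leq$ is a reflexive and transitive relation on $W$; each $R_x \subseteq W \times W$ satisfies: (F1) if $w R_x v$ and $v \leq v'$, then there is $w'$ with $w \leq w'$ and $w' R_x v'$; (F2) if $w \leq w'$ and $w R_x v$, then there is $v'$ with $w' R_x v'$ and $v \leq v'$; (F3) $w R_x u$ iff $u R_{\overline{x}} w$; and $V : W \to 2^{\Phi}$ satisfies: $w \leq u$ implies $V(w) \subseteq V(u)$. A bi-relational $(\Sigma,\mathcal{A})$-model is a bi-relational $\Sigma$-model satisfying the frame condition of each axiom in $\mathcal{A}$: for $[x]A \supset \langle x\rangle A$ the condition is $\forall w \exists u\,(w R_x u)$; for $(\langle x_1\rangle\cdots\langle x_n\rangle A \supset \langle x\rangle A) \land ([x]A \supset [x_1]\cdots[x_n]A)$ it is: for all $w_0,\ldots,w_n$, if $w_0 R_{x_1} w_1, \ldots, w_{n-1} R_{x_n} w_n$, then $w_0 R_x w_n$ (for $n=0$: $w R_x w$ for all $w$). **Satisfaction.** $M,w \Vdash^{\Sigma} p$ iff $p \in V(w)$; $M,w \not\Vdash^{\Sigma} \bot$; $\lor$ and $\land$ are interpreted pointwise as usual;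 $M,w \Vdash^{\Sigma} A \supset B$ iff for all $w' \geq w$, $M,w' \Vdash^{\Sigma} A$ implies $M,w' \Vdash^{\Sigma} B$; $M,w \Vdash^{\Sigma} \langle x\rangle A$ iff there is $v$ with $w R_x v$ and $M,v \Vdash^{\Sigma} A$; $M,w \Vdash^{\Sigma} [x]A$ iff for all $w',v'$, if $w \leq w'$ and $w' R_x v'$, then $M,v' \Vdash^{\Sigma} A$. **Semantic implication.** $\mathscr{A} \Vdash_{\mathcal{A}}^{\Sigma} A$ iff for all bi-relational $(\Sigma,\mathcal{A})$-models $M$ and all worlds $w$ of $M$, if $M,w \Vdash^{\Sigma} B$ for each $B \in \mathscr{A}$, then $M,w \Vdash^{\Sigma} A$. *)

(* Defs.v *)
From Stdlib Require List.
From mathcomp Require Import all_boot.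

Set Implicit Arguments.
Unset Strict Implicit.
Unset Printing Implicit Defensive.

(* [forward] is the set of forward characters and its complement the set of
   backward ones.  The two have the same cardinality since [conv] exchanges
   them bijectively. *)
Record alphabet : Type := Alphabet {
  char :> countType;
  forward : pred char;
  conv : char -> char;
  convK : involutive conv;
  forward_conv : forall x, forward (conv x) = ~~ forward x;
  char_inhabited : inhabited char
}.

Definition atom := nat.

Inductive form (Sigma : alphabet) : Type :=
| Atom of atom
| Bot
| Or of form Sigma & form Sigma
| And of form Sigma & form Sigma
| Imp of form Sigma & form Sigma
| Dia of Sigma & form Sigma
| Box of Sigma & form Sigma.

Arguments Atom {Sigma} _.
Arguments Bot {Sigma}.

Definition Neg (Sigma : alphabet) (A : form Sigma) := Imp A Bot.
Definition Iff (Sigma : alphabet) (A B : form Sigma) :=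
  And (Imp A B) (Imp B A).

Declare Scope form_scope.
Delimit Scope form_scope with F.
Bind Scope form_scope with form.
Notation "⊥" := Bot : form_scope.
Notation "∼ A" := (Neg A) (at level 35, right associativity) : form_scope.
Notation "◇[ x ] A" := (Dia x A)
  (at level 35, right associativity) : form_scope.
Notation "□[ x ] A" := (Box x A)
  (at level 35, right associativity) : form_scope.
Notation "A ⩓ B" := (And A B) (at level 40, left associativity) : form_scope.
Notation "A ⩔ B" := (Or A B) (at level 50, left associativity) : form_scope.
Notation "A ⊃ B" := (Imp A B) (at level 55, right associativity) : form_scope.
Notation "A ⊃⊂ B" := (Iff A B) (at level 56, no associativity) : form_scope.

(* Schemes; together with modus ponens they axiomatize intuitionistic
   propositional logic. *)
Inductive ipl_axiom (Sigma : alphabet) : form Sigma -> Prop :=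
| ipl_K A B : ipl_axiom (A ⊃ B ⊃ A)
| ipl_S A B C : ipl_axiom ((A ⊃ B ⊃ C) ⊃ (A ⊃ B) ⊃ A ⊃ C)
| ipl_andI A B : ipl_axiom (A ⊃ B ⊃ A ⩓ B)
| ipl_andEl A B : ipl_axiom (A ⩓ B ⊃ A)
| ipl_andEr A B : ipl_axiom (A ⩓ B ⊃ B)
| ipl_orIl A B : ipl_axiom (A ⊃ A ⩔ B)
| ipl_orIr A B : ipl_axiom (B ⊃ A ⩔ B)
| ipl_orE A B C : ipl_axiom ((A ⊃ C) ⊃ (B ⊃ C) ⊃ A ⩔ B ⊃ C)
| ipl_botE A : ipl_axiom (⊥ ⊃ A).

Inductive modal_axiom (Sigma : alphabet) : form Sigma -> Prop :=
| modal_A1 x A B : modal_axiom (□[x] (A ⊃ B) ⊃ (□[x] A ⊃ □[x] B))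
| modal_A2 x A B : modal_axiom (□[x] (A ⩓ B) ⊃⊂ (□[x] A ⩓ □[x] B))
| modal_A3 x A B : modal_axiom (◇[x] (A ⩔ B) ⊃⊂ (◇[x] A ⩔ ◇[x] B))
| modal_A4 x A B : modal_axiom (□[x] (A ⊃ B) ⊃ (◇[x] A ⊃ ◇[x] B))
| modal_A5 x A B : modal_axiom ((□[x] A ⩓ ◇[x] B) ⊃ ◇[x] (A ⩓ B))
| modal_A6 x : modal_axiom (∼ ◇[x] ⊥)
| modal_A7 x A :
    modal_axiom ((A ⊃ □[x] ◇[conv x] A) ⩓ (◇[x] □[conv x] A ⊃ A))
| modal_A8 x A B : modal_axiom ((◇[x] A ⊃ □[x] B) ⊃ □[x] (A ⊃ B))
| modal_A9 x A B : modal_axiom (◇[x] (A ⊃ B) ⊃ (□[x] A ⊃ ◇[x] B)).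

(* [Seriality x] and [Path [:: x1; ...; xn] x] name the axiom schemes whose
   instances are given by [instance]; n = 0 is allowed. *)
Inductive extra_axiom (Sigma : alphabet) : Type :=
| Seriality of Sigma
| Path of seq Sigma & Sigma.

Definition Dias (Sigma : alphabet) (xs : seq Sigma) (A : form Sigma) :=
  foldr (@Dia Sigma) A xs.
Definition Boxes (Sigma : alphabet) (xs : seq Sigma) (A : form Sigma) :=
  foldr (@Box Sigma) A xs.

Definition instance (Sigma : alphabet) (a : extra_axiom Sigma)
    (A : form Sigma) : form Sigma :=
  match a with
  | Seriality x => □[x] A ⊃ ◇[x] A
  | Path xs x => (Dias xs A ⊃ ◇[x] A) ⩓ (□[x] A ⊃ Boxes xs A)
  end.

Inductive thm (Sigma : alphabet) (Ax : extra_axiom Sigma -> Prop) :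
    form Sigma -> Prop :=
| thm_ipl A : ipl_axiom A -> thm Ax A
| thm_modal A : modal_axiom A -> thm Ax A
| thm_extra a A : Ax a -> thm Ax (instance a A)
| thm_mp A B : thm Ax (A ⊃ B) -> thm Ax A -> thm Ax B
| thm_nec x A : thm Ax A -> thm Ax (□[x] A).

Fixpoint conjs (Sigma : alphabet) (Bs : seq (form Sigma)) : form Sigma :=
  match Bs with
  | [::] => ⊥ ⊃ ⊥
  | [:: B] => B
  | B :: Bs' => B ⩓ conjs Bs'
  end.

Definition derivable (Sigma : alphabet) (Ax : extra_axiom Sigma -> Prop)
    (S : form Sigma -> Prop) (A : form Sigma) : Prop :=
  exists Bs : seq (form Sigma), List.Forall S Bs /\ thm Ax (conjs Bs ⊃ A).

Record model (Sigma : alphabet) : Type := Model {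
  world :> Type;
  world_inhabited : inhabited world;
  preceq : world -> world -> Prop;
  preceq_refl : forall w, preceq w w;
  preceq_trans : forall u v w, preceq u v -> preceq v w -> preceq u w;
  acc : Sigma -> world -> world -> Prop;
  acc_F1 : forall x w v v', acc x w v -> preceq v v' ->
    exists w', preceq w w' /\ acc x w' v';
  acc_F2 : forall x w w' v, preceq w w' -> acc x w v ->
    exists v', acc x w' v' /\ preceq v v';
  acc_F3 : forall x w u, acc x w u <-> acc (conv x) u w;
  valuation : world -> atom -> Prop;
  valuation_mono : forall w u, preceq w u -> forall p, valuation w p -> valuation u p
}.

(* In the [Path] case only [w 0], ..., [w (size xs)] matter, and the default
   value [x] of [nth] is never used. *)
Definition frame_cond (Sigma : alphabet) (M : model Sigma)
    (a : extra_axiom Sigma) : Prop :=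
  match a with
  | Seriality x => forall w : M, exists u : M, acc x w u
  | Path xs x => forall w : nat -> M,
      (forall i, i < size xs -> acc (nth x xs i) (w i) (w i.+1)) ->
      acc x (w 0) (w (size xs))
  end.

Fixpoint sat (Sigma : alphabet) (M : model Sigma) (w : M) (A : form Sigma) :
    Prop :=
  match A with
  | Atom p => valuation w p
  | Bot => False
  | Or A B => sat w A \/ sat w B
  | And A B => sat w A /\ sat w B
  | Imp A B => forall w' : M, preceq w w' -> sat w' A -> sat w' B
  | Dia x A => exists v : M, acc x w v /\ sat v A
  | Box x A => forall w' v' : M, preceq w w' -> acc x w' v' -> sat v' A
  end.

Definition entails (Sigma : alphabet) (Ax : extra_axiom Sigma -> Prop)
    (S : form Sigma -> Prop) (A : form Sigma) : Prop :=
  forall M : model Sigma, (forall a, Ax a -> frame_cond M a) ->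
  forall w : M, (forall B, S B -> sat w B) -> sat w A.

(* Main.v *)
From Stdlib Require List.
From mathcomp Require Import all_boot.
Require Import Defs.

Set Implicit Arguments.
Unset Strict Implicit.
Unset Printing Implicit Defensive.

(** Soundness: in a model meeting the frame conditions of [Ax], every axiom holds at all worlds, and
    modus ponens and necessitation preserve this ([thm_sound]). Propositional axioms rest on
    persistence along [preceq] ([sat_mono]). Among the modal ones, F3 gives A7, F1 gives A8 and F2
    gives A9; the others follow by unfolding [sat]. For path axioms, nested modalities are read as
    walks ([chain]), which the frame condition contracts to one step. *)

Fixpoint chain (Sigma : alphabet) (M : model Sigma) (xs : seq Sigma)
    (w v : M) : Prop :=
  if xs is x :: xs' then exists u : M, acc x w u /\ chain xs' u v
  else w = v.

(** Bridges two encodings of a walk: [frame_cond] indexes its worlds by [nat], whereas [chain]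
    recurses along [xs] as [Dias] and [Boxes] do. *)
Lemma chain_frame (Sigma : alphabet) (M : model Sigma) (xs : seq Sigma)
    (x : Sigma) (w v : M) :
  frame_cond M (Path xs x) -> chain xs w v -> acc x w v.
Proof.
move=> fr /= ch.
suff [f [<- <- facc]] : exists f : nat -> M,
    [/\ f 0 = w, f (size xs) = v &
        forall i, i < size xs -> acc (nth x xs i) (f i) (f i.+1)].
  exact: fr.
elim: xs w ch {fr} => [|y xs IH] w /=; first by move=> ->; exists (fun=> v).
case=> u [wu /IH [f [f0 fn facc]]].
(* The walk from [u] is shifted by one index to put [w] in front. *)
exists (fun i => if i is j.+1 then f j else w); split=> // -[|i] /= lti.
  by rewrite f0.
exact: facc.
Qed.

(** Implication and box already quantify over later worlds, so transitivity suffices for them; the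
    diamond case needs F2. *)
Lemma sat_mono (Sigma : alphabet) (M : model Sigma) (A : form Sigma) (w w' : M) :
  preceq w w' -> sat w A -> sat w' A.
Proof.
elim: A w w' => [p||A IHA B IHB|A IHA B IHB|A IHA B IHB|x A IHA|x A IHA] w w'
  ww' //=.
- exact: valuation_mono.
- by case=> [/(IHA _ _ ww')|/(IHB _ _ ww')]; [left|right].
- by case=> /(IHA _ _ ww') ? /(IHB _ _ ww').
- by move=> AB u /(preceq_trans ww'); apply: AB.
- case=> v [/(acc_F2 ww') [v' [w'v' vv']] vA].
  by exists v'; split=> //; apply: IHA vA.
- by move=> bA u v /(preceq_trans ww'); apply: bA.
Qed.

Lemma sat_Dias (Sigma : alphabet) (M : model Sigma) (xs : seq Sigma)
    (A : form Sigma) (w : M) :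
  sat w (Dias xs A) -> exists v : M, chain xs w v /\ sat v A.
Proof.
elim: xs w => [|x xs IH] w /=; first by exists w.
by case=> u [wu /IH [v [uv vA]]]; exists v; split=> //; exists u.
Qed.

(* [F1] lets the steps up along the order that nested boxes allow between two
   accessibility steps be postponed to a single one in front of the chain. *)
Lemma sat_Boxes (Sigma : alphabet) (M : model Sigma) (xs : seq Sigma)
    (A : form Sigma) (w : M) :
  (forall w' v : M, preceq w w' -> chain xs w' v -> sat v A) ->
  sat w (Boxes xs A).
Proof.
elim: xs w => [|x xs IH] w wA /=.
  exact: wA (preceq_refl w) (erefl w).
move=> w1 v1 ww1 w1v1; apply: IH => v2 v v1v2 v2v.
have [w2 [w1w2 w2v2]] := acc_F1 w1v1 v1v2.
by apply: (wA w2); [exact: preceq_trans w1w2 | exists v2].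
Qed.

Lemma ipl_axiom_sound (Sigma : alphabet) (M : model Sigma) (A : form Sigma) :
  ipl_axiom A -> forall w : M, sat w A.
Proof.
case=> [A1 B|A1 B C|A1 B|A1 B|A1 B|A1 B|A1 B|A1 B C|A1] w /=.
- by move=> u _ uA v uv _; apply: sat_mono uA.
- move=> u _ uABC v uv vAB t vt tA.
  by apply: (uABC t (preceq_trans uv vt) tA t (preceq_refl t)); apply: vAB.
- by move=> u _ uA v uv vB; split=> //; apply: sat_mono uA.
- by move=> u _ [].
- by move=> u _ [].
- by move=> u _; left.
- by move=> u _; right.
- move=> u _ uAC v uv vBC t vt [tA|tB]; last exact: vBC.
  by apply: (uAC t) => //; apply: preceq_trans vt.
- by [].
Qed.

Lemma modal_axiom_sound (Sigma : alphabet) (M : model Sigma) (A : form Sigma) :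
  modal_axiom A -> forall w : M, sat w A.
Proof.
case=> [x A1 B|x A1 B|x A1 B|x A1 B|x A1 B|x|x A1|x A1 B|x A1 B] w /=.
- move=> u _ uAB v uv vA w' v' vw' w'v'.
  apply: (uAB w' v' (preceq_trans uv vw') w'v' v' (preceq_refl v')).
  exact: vA w'v'.
- split=> u _ => [uAB|[uA uB] w' v' uw' w'v'].
    by split=> w' v' uw' /(uAB _ _ uw') [].
  by split; [apply: uA w'v' | apply: uB w'v'].
- split=> u _ => [[v [uv [vA|vB]]]|[[v [uv vA]]|[v [uv vB]]]].
  + by left; exists v.
  + by right; exists v.
  + by exists v; split=> //; left.
  + by exists v; split=> //; right.
- move=> u _ uAB v uv [t [vt tA]]; exists t; split=> //.
  exact: uAB uv vt t (preceq_refl t) tA.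
- move=> u _ [uA [v [uv vB]]]; exists v; do 2!split=> //.
  exact: uA (preceq_refl u) uv.
- by move=> u _ [v []].
- split=> u _ => [uA w' v' uw' w'v'|[v [uv vA]]].
    (* F3 turns the step from [w'] to [v'] around, and [A1] persists from [u] to [w']. *)
    by exists w'; split; [apply: (iffLR (acc_F3 _ _ _)) | apply: sat_mono uA].
  by apply: (vA v u (preceq_refl v)); apply: (iffLR (acc_F3 _ _ _)).
- move=> u _ uAB w' v' uw' w'v' v'' v'v'' vA.
  (* A8: F1 lifts [w'] to a world that sees [v''], where the diamond premise therefore holds. *)
  have [w'' [w'w'' w''v'']] := acc_F1 w'v' v'v''.
  apply: (uAB w'' (preceq_trans uw' w'w'') _ w'' v'' (preceq_refl w'')) => //.
  by exists v''.
- move=> u _ [v [uv vAB]] t ut tA.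
  (* A9: F2 yields a successor of [t] above [v], where the implication known at [v] applies. *)
  have [s [ts vs]] := acc_F2 ut uv.
  by exists s; split=> //; apply: vAB vs _; apply: tA (preceq_refl t) ts.
Qed.

Lemma extra_axiom_sound (Sigma : alphabet) (M : model Sigma)
    (a : extra_axiom Sigma) (A : form Sigma) :
  frame_cond M a -> forall w : M, sat w (instance a A).
Proof.
case: a => [x|xs x] fr w.
  move=> u _ uA; have [v uv] := fr u.
  by exists v; split=> //; apply: uA (preceq_refl u) uv.
split=> u _ => [/sat_Dias [v [uv vA]]|uA].
  by exists v; split=> //; apply: chain_frame fr uv.
by apply: sat_Boxes => w' v uw' w'v; apply: uA uw' (chain_frame fr w'v).
Qed.

(** The induction must range over all worlds, since necessitation uses its premise at a
    successor. *)
Lemma thm_sound (Sigma : alphabet) (Ax : extra_axiom Sigma -> Prop)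
    (M : model Sigma) (A : form Sigma) :
  (forall a, Ax a -> frame_cond M a) -> thm Ax A -> forall w : M, sat w A.
Proof.
move=> fr; elim=> {A} [A /ipl_axiom_sound //|A /modal_axiom_sound //|a A /fr|
  A B _ AB _ vA w|x A _ vA w w' v' _ _].
- exact: extra_axiom_sound.
- exact: AB (preceq_refl w) (vA w).
- exact: vA.
Qed.

Lemma sat_conjs (Sigma : alphabet) (M : model Sigma) (Bs : seq (form Sigma))
    (w : M) :
  List.Forall (sat w) Bs -> sat w (conjs Bs).
Proof.
elim: Bs => [_ u _ []|B Bs IH /List.Forall_cons_iff [wB]].
(* A singleton is its own case of [conjs], so the tail must be inspected before [conjs] unfolds. *)
case: Bs IH => [|C Bs] IH wBs //=.
by split=> //; apply: IH.
Qed.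

Theorem theorem1 (Sigma : alphabet) (Ax : extra_axiom Sigma -> Prop)
    (S : form Sigma -> Prop) (A : form Sigma) :
  derivable Ax S A -> entails Ax S A.
Proof.
case=> Bs [SBs /thm_sound BsA] M /BsA sound w wS.
apply: (sound w w (preceq_refl w)); apply: sat_conjs.
exact: List.Forall_impl SBs.
Qed.
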